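(* Let $S$ be a finite left-regular band (LRB) with identity, with lattice of supports $L$ and support map $\operatorname{supp}\colon S\to L$, and let $C\subseteq S$ be its set of chambers. Let $\{w_x\}_{x\in S}$ be a probability distribution on $S$, and let $P$ be the transition matrix of the random walk on chambers: $$P(c,d)=\sum_{x\in S,\ xc=d} w_x\qquad (c,d\in C).$$ Then $P$ is diagonalizable (over $\mathbb{R}$). It has an eigenvalue $$\lambda_X=\sum_{y\in S,\ \operatorname{supp} y\le X} w_y$$ for each $X\in L$, with multiplicity $m_X$, where the $m_X$ are determined by $$\sum_{Y\in L,\ Y\ge X} m_Y=c_X\qquad\text{for each }X\in L.$$ Equivalently, $$m_X=\sum_{Y\in L,\ Y\ge X}\mu(X,Y)\,c_Y,$$ where $\mu$ is the Möbius function of the lattice $L$.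
   Context: A finite semigroup $S$ with identity is a left-regular band (LRB) if there are a lattice $L$ (the lattice of supports) and a surjection $\operatorname{supp}\colon S\to L$ such that $\operatorname{supp}(xy)=\operatorname{supp}x\vee\operatorname{supp}y$ for all $x,y\in S$, and $xy=x$ whenever $\operatorname{supp}y\le\operatorname{supp}x$. (Equivalently: $x^2=x$ and $xyx=xy$ for all $x,y\in S$.) $S$ is partially ordered by $x\le y\iff xy=y$. Let $\hat 1$ be the largest element of $L$. A chamber is an element $c\in S$ with $\operatorname{supp}c=\hat 1$; the set $C$ of chambers is a two-sided ideal. For $X\in L$, $c_X$ denotes the number of chambers $c\in C$ with $c\ge x$, where $x$ is any fixed element of $S$ with $\operatorname{supp}x=X$ (this number does not depend on the choice of $x$). Multiplicity convention: the eigenvalues of $P$, counted with multiplicity, are the numbers $\lambda_X$ ($X\in L$), each listed $m_X$ times; if several $X$ have the same value $\lambda_X$ their multiplicities add, and if $m_X=0$ then $X$ contributes nothing. *)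

(* Defs.v *)
From HB Require Import structures.
From mathcomp Require Import all_boot all_order all_algebra.
From mathcomp Require Import reals.

Set Implicit Arguments.
Unset Strict Implicit.
Unset Printing Implicit Defensive.

Import Order.TTheory GRing.Theory Num.Theory.

Local Open Scope ring_scope.

#[short(type="finMonoidType")]
HB.structure Definition FinMonoid := {S of Monoid S & Finite S}.

(* The lattice of supports L is the image of a nonempty finite semigroup, hence
   a nonempty finite lattice, which is exactly [finTBLatticeType]; its largest
   element is [\top]. *)
HB.mixin Record Monoid_isLRB d (L : finTBLatticeType d) S
    of Monoid S & Finite S := {
  supp : S -> L;
  supp_surj : forall X : L, exists x : S, supp x == X;
  suppM : forall x y : S, supp (x * y)%g = Order.join (supp x) (supp y);
  mulg_supp_le : forall x y : S, (supp y <= supp x)%O -> (x * y)%g = x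
}.

#[short(type="lrbType")]
HB.structure Definition LRB d (L : finTBLatticeType d) :=
  {S of Monoid_isLRB d L S & Monoid S & Finite S}.

Arguments supp {d L s}.
Arguments supp_surj {d L} s X.

Section LeftRegularBand.
Context {d : Order.disp_t} {L : finTBLatticeType d} (S : lrbType L).

(* Larger elements are finer: the identity of S is the least element and the
   chambers are the maximal ones. *)
Definition lrb_le (x y : S) : bool := (x * y)%g == y.

Definition chambers : {set S} := [set c | supp c == \top%O].

Definition nchambers_above (x : S) : nat := #|[set c in chambers | lrb_le x c]|.

Definition supp_repr (X : L) : S := xchoose (supp_surj S X).

(* The number c_X; [nchambersE] below shows that the choice of a representative
   of X is immaterial. *)
Definition nchambers (X : L) : nat := nchambers_above (supp_repr X).

Lemma supp_reprK (X : L) : supp (supp_repr X) = X.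
Proof. exact/eqP/(xchooseP (supp_surj S X)). Qed.

Lemma nchambers_above_le (x y : S) :
  supp x = supp y -> (nchambers_above x <= nchambers_above y)%N.
Proof.
move=> sxy; rewrite /nchambers_above.
have xyx : (x * y)%g = x by apply: mulg_supp_le; rewrite sxy.
have yy : (y * y)%g = y by apply: mulg_supp_le.
have y_inj : {in [set c in chambers | lrb_le x c] &, injective (fun c => (y * c)%g)}.
  move=> c c'; rewrite !inE => /andP[_ /eqP xc] /andP[_ /eqP xc'] ycc'.
  by rewrite -xc -xc' -xyx -!mulgA ycc'.
rewrite -(card_in_imset y_inj).
apply/subset_leq_card/subsetP => u /imsetP[c].
rewrite !inE => /andP[/eqP sc _] ->.
by rewrite suppM sc joinx1 eqxx /lrb_le mulgA yy eqxx.
Qed.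

Lemma nchambersE (x : S) : nchambers (supp x) = nchambers_above x.
Proof.
by apply/eqP; rewrite eqn_leq !nchambers_above_le ?supp_reprK.
Qed.

(* Rows and columns are indexed by the enumeration [enum_val] of the chambers. *)
Definition walk_matrix (R : realType) (w : S -> R) : 'M[R]_#|chambers| :=
  \matrix_(i, j) \sum_(x : S | (x * enum_val i)%g == enum_val j) w x.

Definition walk_eigenvalue (R : realType) (w : S -> R) (X : L) : R :=
  \sum_(y : S | (supp y <= X)%O) w y.

End LeftRegularBand.

Section Moebius.
Context {d : Order.disp_t} {L : finPOrderType d}.

(* The recursion over the elements strictly below Y is run with fuel;
   [moebiusE] gives the defining recursion. *)
Fixpoint moebius_rec (n : nat) (X Y : L) : int :=
  if X == Y then 1 else
  if n is n'.+1 then - \sum_(Z | (X <= Z < Y)%O) moebius_rec n' X Z else 0.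

Definition moebius (X Y : L) : int := moebius_rec #|L| X Y.

Lemma moebius_rec_fuel (m n : nat) (X Y : L) :
  (#|[set Z | (Z < Y)%O]| <= m)%N -> (#|[set Z | (Z < Y)%O]| <= n)%N ->
  moebius_rec m X Y = moebius_rec n X Y.
Proof.
have down (Z T : L) (k : nat) : (Z < T)%O ->
    (#|[set U | (U < T)%O]| <= k.+1)%N -> (#|[set U | (U < Z)%O]| <= k)%N.
  move=> ZT Tk; rewrite -ltnS; apply: leq_trans Tk; apply: proper_card.
  apply/properP; split; last by exists Z; rewrite !inE ?ltxx.
  by apply/subsetP => U; rewrite !inE => /lt_trans; apply.
have low0 (k : nat) (T : L) : (#|[set U | (U < T)%O]| <= 0)%N ->
    moebius_rec k X T = if X == T then 1 else 0.
  rewrite leqn0 cards_eq0 => /eqP T0; case: k => [|k] //=.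
  case: ifP => // _; rewrite big_pred0 ?oppr0 // => Z.
  by have := in_set0 Z; rewrite -T0 inE => ->; rewrite andbF.
elim: m n Y => [|m IHm] [|n] Y hm hn //; rewrite ?(low0 _ _ hm) ?(low0 _ _ hn) //=.
case: ifP => // _; congr (- _); apply: eq_bigr => Z /andP[_ ZY].
by apply: IHm; apply: down ZY _.
Qed.

Lemma moebiusE (X Y : L) :
  moebius X Y =
  if X == Y then 1 else - \sum_(Z | (X <= Z < Y)%O) moebius X Z.
Proof.
rewrite /moebius (@moebius_rec_fuel _ #|L|.+1) ?max_card //.
exact: leq_trans (max_card _) (leqnSn _).
Qed.

End Moebius.

(* Main.v *)
Require Import Defs.
From HB Require Import structures.
From mathcomp Require Import all_boot all_order all_algebra.
From mathcomp Require Import reals.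

Set Implicit Arguments.
Unset Strict Implicit.
Unset Printing Implicit Defensive.

Import Order.TTheory GRing.Theory Num.Theory.

Local Open Scope ring_scope.

(** Left multiplication by [x] acts linearly on the vector space spanned by the
chambers, through a 0/1 matrix [chamber_mx x], and the transition matrix of the
walk is the combination of these matrices with coefficients [w x]. Three facts
about such a combination [P] give the theorem; they hold for any linear
representation of the band whose traces depend on supports only.

Diagonalizability ([walk_operator_annihilated]). Since [x * z = x] as soon as
the support of [z] lies below that of [x], the product of
[P - lambda_(supp x)] and [T x], the matrix of [x], consists only of the terms
[w z *: T (x * z)] in which [z] enlarges the support of [x] ([walk_operator_shift]). As the weights are
nonnegative, such a term has [w z = 0] or belongs to a strictly larger
eigenvalue. Induction on the eigenvalues from the top down shows that the
product of the [P - lambda], over the distinct values [lambda], kills [T x] for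
every [x], hence for the identity of the band; so the minimal polynomial has
simple roots.

Multiplicities ([trace_walk_operator_exp]). The weights on [S] form an algebra
under convolution, and for each [X] the partial sum [lambda_X] is a character of
it. So [P ^+ k] is again a walk operator, with eigenvalues [lambda_X ^+ k], and
the trace [c_(supp x)] of [T x], once written as the sum of the [m_Y] over
[Y >= supp x], gives that the trace of [P ^+ k] is the sum of the
[m_X * lambda_X ^+ k]. A diagonalizable matrix is determined up to similarity by
the traces of its powers ([weighted_power_sums]), so the eigenspace of [a] has
dimension the sum of the [m_X] over all [X] with [lambda_X = a].

Nonnegativity ([multiplicity_ge0]). The integers [m_X], produced by Moebius
inversion, depend on the band only. For each [X] there are nonnegative weights
for which no other [Y] has the same eigenvalue as [X] ([separating_weight]), and
for these [m_X] is the dimension of an eigenspace. *)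

(** * Diagonalizable matrices: eigenspaces and traces of powers *)

Section DiagonalizableSpectrum.
Context {F : fieldType}.

Lemma mxrank_diag_le n (D : 'rV[F]_n) :
  (\rank (diag_mx D) <= #|[set i | (D 0 i != 0)%R]|)%N.
Proof.
rewrite diag_mx_sum_delta -sum1dep_card [leqRHS]big_mkcond /=.
apply: (big_ind2 (fun A k => (\rank A <= k)%N)) => [|A a B b hA hB|i _]; first by rewrite mxrank0.
  exact: leq_trans (mxrank_add A B) (leq_add hA hB).
have [->|nz] /= := eqVneq; first by rewrite scale0r mxrank0.
by rewrite mxrank_scale_nz // mxrank_delta.
Qed.

(** The lower bound comes from adding the diagonal matrix that is 1 exactly where
[D] vanishes: the sum is invertible, and rank is subadditive. *)
Lemma mxrank_diag n (D : 'rV[F]_n) :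
  \rank (diag_mx D) = #|[set i | (D 0 i != 0)%R]|.
Proof.
apply/eqP; rewrite eqn_leq mxrank_diag_le /=.
pose E : 'rV[F]_n := \row_i (if D 0 i == 0 then 1 else 0).
have cardE : (#|[set i | (D 0 i != 0)%R]| + #|[set i | (E 0 i != 0)%R]|)%N = n.
  rewrite -[RHS]card_ord -(cardsC [set i | D 0 i != 0]); congr (_ + _)%N.
  by apply: eq_card => i; rewrite !inE mxE negbK; case: ifP; rewrite ?oner_eq0 ?eqxx.
have rDE : \rank (diag_mx D + diag_mx E)%R = n.
  apply/mxrank_unit.
  have -> : diag_mx D + diag_mx E = diag_mx (D + E) by rewrite linearD.
  rewrite unitmxE det_diag unitfE; apply/prodf_neq0 => i _.
  by rewrite !mxE; case: (eqVneq (D 0 i) 0) => [->|nz]; rewrite ?add0r ?addr0 ?oner_eq0.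
rewrite -(leq_add2r #|[set i | (E 0 i != 0)%R]|) cardE -{1}rDE.
exact: leq_trans (mxrank_add _ _) (leq_add (leqnn _) (mxrank_diag_le E)).
Qed.

(** A single diagonal form [D] witnesses all three invariants at once, so that
counting the entries of [D] relates them to one another. *)
Lemma diagonalizable_spectrum n (A : 'M[F]_n) : diagonalizable A ->
  exists D : 'rV[F]_n,
    [/\ char_poly A = \prod_i ('X - (D 0 i)%:P),
        forall a, \rank (eigenspace A a) = #|[set i | D 0 i == a]| &
        forall k, \tr (A ^+ k) = \sum_i D 0 i ^+ k].
Proof.
move=> [P Pu /similar_diagPex [D /(similarP Pu) PA]]; exists D.
have defA : A = invmx P *m diag_mx D *m P by rewrite -mulmxA -PA mulKmx.
split=> [|a|k].
- have: map_mx polyC P *m char_poly_mx A = char_poly_mx (diag_mx D) *m map_mx polyC P.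
    rewrite /char_poly_mx mulmxBr mulmxBl -!map_mxM PA; congr (_ - _).
    exact: scalar_mxC.
  move=> /(congr1 determinant); rewrite !det_mulmx mulrC => /mulIf.
  rewrite -/(char_poly A) -/(char_poly (diag_mx D)) => ->.
    rewrite char_poly_trig ?diag_mx_is_trig //.
    by apply: eq_bigr => i _; rewrite !mxE eqxx.
  by rewrite det_map_mx polyC_eq0 -unitfE -unitmxE.
- rewrite /eigenspace mxrank_ker.
  have -> : \rank (A - a%:M)%R = \rank (diag_mx (D - const_mx a))%R.
    rewrite linearB /= diag_const_mx.
    have -> : A - a%:M = invmx P *m (diag_mx D - a%:M) *m P.
      by rewrite mulmxBr mulmxBl defA -!mulmxA -scalar_mxC mulKmx.
    rewrite mxrankMfree ?row_free_unit // -mxrank_tr trmx_mul mxrankMfree ?mxrank_tr //.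
    by rewrite row_free_unit unitmx_tr unitmx_inv.
  rewrite mxrank_diag -[n in (n - _)%N]card_ord -(cardsC [set i | D 0 i == a]).
  rewrite [X in (_ - X)%N](_ : _ = #|~: [set i | D 0 i == a]|) ?addnK //.
  by apply: eq_card => i; rewrite !inE !mxE subr_eq0.
- have -> : A ^+ k = invmx P *m diag_mx (map_mx (fun x => x ^+ k) D) *m P.
    elim: k => [|k IHk].
      rewrite expr0 (_ : diag_mx _ = 1%:M) ?mulmx1 ?mulVmx //.
      by rewrite -diag_const_mx; congr diag_mx; apply/rowP => i; rewrite !mxE expr0.
    rewrite exprSr -[A ^+ k * A]/(A ^+ k *m A) IHk [in LHS]defA !mulmxA mulmxK //.
    congr (_ *m _); rewrite -mulmxA mulmx_diag; congr (_ *m diag_mx _).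
    by apply/rowP => i; rewrite !mxE exprSr.
  rewrite mxtrace_mulC mulmxA mulmxV // mul1mx mxtrace_diag.
  by apply: eq_bigr => i _; rewrite mxE.
Qed.

Lemma annihilated_diagonalizable n (A : 'M[F]_n.+1) (s : seq F) :
  horner_mx A (\prod_(a <- undup s) ('X - a%:P)) = 0 -> diagonalizable A.
Proof.
move=> A0; apply/diagonalizableP; exists (undup s); first exact: undup_uniq.
exact: mxminpoly_min.
Qed.

End DiagonalizableSpectrum.

(** * Weighted power sums determine multiplicities *)

Section PowerSums.
Context {F : numFieldType}.

(** Both sides extend linearly from monomials to polynomials; a polynomial that
vanishes at every [x i] and [y j] other than [a], but not at [a], then isolates
the contribution of [a]. The integers [m j] may be negative. *)
Lemma weighted_power_sums (I J : finType) (x : I -> F) (y : J -> F) (m : J -> int) :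
  (forall k, \sum_i x i ^+ k = \sum_j (m j)%:~R * y j ^+ k) ->
  forall a, \sum_(j | y j == a) m j = #|[set i | x i == a]|%:Z.
Proof.
move=> pow a.
have polyE (q : {poly F}) : \sum_i q.[x i] = \sum_j (m j)%:~R * q.[y j].
  under eq_bigr do rewrite horner_coef.
  rewrite exchange_big /=; under [RHS]eq_bigr do rewrite horner_coef mulr_sumr.
  rewrite [RHS]exchange_big /=; apply: eq_bigr => k _.
  by rewrite -mulr_sumr pow mulr_sumr; apply: eq_bigr => j _; rewrite mulrCA.
pose s := filter (predC1 a) (codom x ++ codom y).
(* [q] is, up to the scalar [q.[a]], the Lagrange polynomial of [a]. *)
pose q : {poly F} := \prod_(b <- s) ('X - b%:P).
have qE b : b \in codom x ++ codom y -> q.[b] = (b == a)%:R * q.[a].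
  move=> bs; have [->|nba] := eqVneq; first by rewrite mul1r.
  by rewrite mul0r; apply/eqP; rewrite -/(root _ _) root_prod_XsubC mem_filter /= nba.
have qa0 : q.[a] != 0 by rewrite -/(root _ _) root_prod_XsubC mem_filter /= eqxx.
apply/eqP; rewrite -(eqr_int F) rmorph_sum /=; apply/eqP.
have xE i : q.[x i] = (x i == a)%:R * q.[a] by rewrite qE // mem_cat codom_f.
have yE j : q.[y j] = (y j == a)%:R * q.[a] by rewrite qE // mem_cat codom_f orbT.
apply: (mulIf qa0); rewrite -sum1dep_card -pmulrn natr_sum !mulr_suml.
rewrite [RHS]big_mkcond [LHS]big_mkcond; transitivity (\sum_j (m j)%:~R * q.[y j]).
  apply: eq_bigr => j _; rewrite yE.
  by case: eqP; rewrite /= ?mul1r ?mul0r ?mulr0.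
rewrite -polyE; apply: eq_bigr => i _; rewrite xE.
by case: eqP; rewrite /= ?mul1r ?mul0r.
Qed.

Lemma prod_by_multiplicity (A : comPzRingType) (I J : finType) (x : I -> F)
    (y : J -> F) (m : J -> nat) (f : F -> A) :
  (forall a, #|[set i | x i == a]| = (\sum_(j | y j == a) m j)%N) ->
  \prod_i f (x i) = \prod_j f (y j) ^+ m j.
Proof.
move=> mult.
pose s := flatten [seq nseq (m j) (y j) | j <- index_enum J].
have xs : perm_eq [seq x i | i <- index_enum I] s.
  apply/allP => a _ /=; rewrite /s count_map -sum1_count.
  rewrite count_flatten sumnE !big_map sum1dep_card mult big_mkcond.
  by apply/eqP/eq_bigr => j _; rewrite count_nseq /=; case: eqP; rewrite ?mul1n.
rewrite -(big_map x predT f) (perm_big _ xs) big_flatten big_map /=.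
by apply: eq_bigr => j _; rewrite big_nseq iter_mulr_1.
Qed.
End PowerSums.

(** * Moebius inversion over upper sets *)

Section MoebiusInversion.
Context {d : Order.disp_t} {L : finPOrderType d}.

Lemma sum_moebius (X Z : L) : (X <= Z)%O ->
  \sum_(Y | (X <= Y <= Z)%O) moebius X Y = (X == Z)%:R.
Proof.
move=> XZ; rewrite (bigD1 Z) /= ?XZ ?lexx // moebiusE.
have [->|nXZ] := eqVneq; last first.
  rewrite [X in _ + X](eq_bigl (fun Y => (X <= Y < Z)%O)) ?addNr // => Y.
  by rewrite lt_neqAle -andbA [(_ <= _)%O && (_ != _)]andbC.
rewrite big_pred0 ?addr0 // => Y.
apply: negbTE; rewrite negb_and negbK orbC; have [//|/=] := eqVneq.
by rewrite -eq_le eq_sym => /negbTE->.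
Qed.

(** The square matrix of Moebius values is a left inverse of the zeta matrix by
[sum_moebius], hence also a right inverse. *)
Lemma sum_moebius_l (X Z : L) : (X <= Z)%O ->
  \sum_(Y | (X <= Y <= Z)%O) moebius Y Z = (X == Z)%:R.
Proof.
move=> XZ.
have sumE (G : L -> int) : \sum_(k < #|L|) G (enum_val k) = \sum_Y G Y.
  by rewrite [RHS](reindex (fun k : 'I_#|L| => enum_val k)) //=; exact/onW_bij/enum_val_bij.
pose zeta : 'M[int]_#|L| := \matrix_(i, j) (enum_val i <= enum_val j)%O%:R.
pose mu : 'M[int]_#|L| := \matrix_(i, j)
  if (enum_val i <= enum_val j)%O then moebius (enum_val i) (enum_val j) else 0.
have muz : mu *m zeta = 1%:M.
  apply/matrixP => i j; rewrite !mxE.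
  under eq_bigr => k _ do rewrite !mxE mulr_natr mulrb.
  rewrite (sumE (fun Y => if (Y <= enum_val j)%O then
     if (enum_val i <= Y)%O then moebius (enum_val i) Y else 0 else 0)) /=.
  rewrite -big_mkcond -big_mkcondr /= -(inj_eq enum_val_inj).
  case ij : (enum_val i <= enum_val j)%O; last first.
    rewrite big_pred0 => [|Y]; first by case: eqP ij => // ->; rewrite lexx.
    by apply/negbTE/negP => /andP[Yj iY]; rewrite (le_trans iY Yj) in ij.
  by rewrite -sum_moebius //; apply: eq_bigl => Y; rewrite andbC.
have /matrixP/(_ (enum_rank X) (enum_rank Z)) := mulmx1C muz.
rewrite !mxE (inj_eq enum_rank_inj) => <-.
under [RHS]eq_bigr => k _ do rewrite !mxE !enum_rankK mulr_natl mulrb.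
rewrite (sumE (fun Y => if (X <= Y)%O then
     if (Y <= Z)%O then moebius Y Z else 0 else 0)) /=.
by rewrite -big_mkcond -big_mkcondr.
Qed.

Lemma moebius_inversion (n c : L -> int) :
  (forall X, \sum_(Y | (X <= Y)%O) n Y = c X) <->
  (forall X, n X = \sum_(Y | (X <= Y)%O) moebius X Y * c Y).
Proof.
split=> h X.
  under eq_bigr => Y _ do rewrite -h mulr_sumr.
  rewrite (exchange_big_dep (fun Z => (X <= Z)%O)) /= => [|Y Z XY]; last exact: le_trans.
  rewrite (eq_bigr (fun Z => (X == Z)%:R * n Z)) => [|Z XZ]; last first.
    by rewrite -mulr_suml sum_moebius.
  rewrite (bigD1 X) //= eqxx mul1r big1 ?addr0 // => Z /andP[_ /negbTE].
  by rewrite eq_sym => ->; rewrite mul0r.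
under eq_bigr => Y _ do rewrite h.
rewrite (exchange_big_dep (fun Z => (X <= Z)%O)) /= => [|Y Z XY]; last exact: le_trans.
rewrite (eq_bigr (fun Z => (X == Z)%:R * c Z)) => [|Z XZ]; last first.
  by rewrite -mulr_suml sum_moebius_l.
rewrite (bigD1 X) //= eqxx mul1r big1 ?addr0 // => Z /andP[_ /negbTE].
by rewrite eq_sym => ->; rewrite mul0r.
Qed.
End MoebiusInversion.

(** * How the eigenvalues depend on the support *)

Section SupportWeights.
Context {d : Order.disp_t} {L : finTBLatticeType d} {S : lrbType L} {R : realType}.
Implicit Types (x y z : S) (X Y : L) (w : S -> R).

Lemma walk_eigenvalue_lt w x z : (forall y, 0 <= w y) ->
  0 < w z -> ~~ (supp z <= supp x)%O ->
  walk_eigenvalue w (supp x) < walk_eigenvalue w (supp (x * z)%g).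
Proof.
move=> w0 wz zx; rewrite /walk_eigenvalue suppM.
rewrite [ltRHS](bigD1 z) ?leUr //= addrC -[ltLHS]addr0 ler_ltD //.
rewrite big_mkcond [leRHS]big_mkcond; apply: ler_sum => y _ /=.
case: ifP => [yx|_]; last by case: ifP.
rewrite (le_trans yx (leUl _ _)) /=.
by case: eqVneq => [yz|]; first by rewrite -yz yx in zx.
Qed.

(** Elements whose support is not below [X] get a weight exceeding the total
weight of all the others: an eigenvalue at [Y] not below [X] is then too large to
equal the one at [X], and an eigenvalue at [Y] strictly below [X] is too small. *)
Definition separating_weight X y : R := if (supp y <= X)%O then 1 else #|S|.+1%:R.

Lemma separating_weight_ge0 X y : 0 <= separating_weight X y.
Proof. by rewrite /separating_weight; case: ifP. Qed.

Lemma separating_weightP X Y :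
  (walk_eigenvalue (separating_weight X) Y ==
   walk_eigenvalue (separating_weight X) X) = (Y == X).
Proof.
apply/eqP/eqP => [|-> //]; set w := separating_weight X => eqYX.
have [YX|nYX] := boolP (Y <= X)%O; last first.
  suff: walk_eigenvalue w X < walk_eigenvalue w Y by rewrite eqYX ltxx.
  have -> : walk_eigenvalue w X = #|[set y : S | (supp y <= X)%O]|%:R.
    rewrite /walk_eigenvalue -sum1dep_card natr_sum.
    by apply: eq_bigr => y yX; rewrite /w /separating_weight yX.
  apply: (@lt_le_trans _ _ #|S|.+1%:R); first by rewrite ltr_nat ltnS max_card.
  rewrite /walk_eigenvalue (bigD1 (supp_repr S Y)) ?supp_reprK //=.
  rewrite {1}/w /separating_weight supp_reprK (negbTE nYX) lerDl sumr_ge0 // => y _.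
  exact: separating_weight_ge0.
(* If [Y] were strictly below [X], the element of support [X], which has weight 1,
   would count at [X] but not at [Y]. *)
apply/eqP; rewrite eq_le YX /=; apply/negPn/negP => nXY.
suff: walk_eigenvalue w Y < walk_eigenvalue w X by rewrite eqYX ltxx.
rewrite -(join_r YX) -(supp_reprK S Y) -(supp_reprK S X) -suppM.
apply: walk_eigenvalue_lt; rewrite ?supp_reprK //; first exact: separating_weight_ge0.
by rewrite /w /separating_weight supp_reprK lexx.
Qed.

End SupportWeights.

(** * Walk operators in a representation of the band *)

Section Representation.
Context {d : Order.disp_t} {L : finTBLatticeType d} {S : lrbType L} {R : realType}.
Implicit Types (x y z : S) (X Y : L) (w : S -> R).

(** The product is reversed because matrices act on row vectors, whose row [i]
of [T x] is the image under [x] of the basis vector [i]. *)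
Definition lrb_representation n (T : S -> 'M[R]_n) : Prop :=
  T 1%g = 1%:M /\ forall x y, T (x * y)%g = T y *m T x.

Definition walk_operator n (T : S -> 'M[R]_n) w : 'M[R]_n := \sum_x w x *: T x.

Lemma walk_operator_shift n (T : S -> 'M[R]_n) w x : lrb_representation T ->
  (walk_operator T w - (walk_eigenvalue w (supp x))%:M) *m T x =
  \sum_(z | ~~ (supp z <= supp x)%O) w z *: T (x * z)%g.
Proof.
move=> [_ TM]; rewrite mulmxBl mulmx_suml mul_scalar_mx scaler_suml.
under eq_bigr => z _ do rewrite -scalemxAl -TM.
rewrite (bigID (fun z => (supp z <= supp x)%O)) /= addrAC.
rewrite [X in X - _](eq_bigr (fun z => w z *: T x)) ?addrN ?add0r // => z zx.
by rewrite mulg_supp_le.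
Qed.

(** The sequence [s] may contain other values than the eigenvalues above that of
[x]; this lets the induction remove just [walk_eigenvalue w (supp x)]. *)
Lemma walk_operator_annihilated n (T : S -> 'M[R]_n.+1) w (s : seq R) x :
  lrb_representation T -> (forall y, 0 <= w y) ->
  (forall Y, walk_eigenvalue w (supp x) <= walk_eigenvalue w Y ->
     walk_eigenvalue w Y \in s) ->
  horner_mx (walk_operator T w) (\prod_(a <- s) ('X - a%:P)) *m T x = 0.
Proof.
move=> repT w0.
have [k] := ubnP (size s); elim: k => // k IHk in s x *; rewrite ltnS => sk hs.
have lxs := hs _ (lexx _).
(* The factor at the eigenvalue of [x] is moved to the right, next to [T x]. *)
rewrite (perm_big _ (perm_to_rem lxs)) big_cons /= mulrC rmorphM /= -[_ * _]/(_ *m _).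
rewrite -mulmxA rmorphB /= horner_mx_X horner_mx_C walk_operator_shift //.
rewrite mulmx_sumr big1 // => z zx; rewrite -scalemxAr.
have [->|wz] := eqVneq (w z) 0; first by rewrite scale0r.
have lxz : walk_eigenvalue w (supp x) < walk_eigenvalue w (supp (x * z)%g).
  by apply: walk_eigenvalue_lt => //; rewrite lt_def wz w0.
rewrite IHk ?scaler0 //.
  by rewrite size_rem // (leq_trans _ sk) // prednK //; case: (s) lxs.
move=> Y lY; have lxY := lt_le_trans lxz lY.
have := hs Y (ltW lxY); rewrite (perm_mem (perm_to_rem lxs)) inE.
by rewrite gt_eqF.
Qed.

Lemma walk_operator_diagonalizable n (T : S -> 'M[R]_n) w :
  lrb_representation T -> (forall y, 0 <= w y) ->
  diagonalizable (walk_operator T w).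
Proof.
case: n T => [|n] T repT w0.
  by rewrite (_ : walk_operator T w = 0) ?flatmx0 //; exact: diagonalizable0.
apply: (@annihilated_diagonalizable _ _ _ (codom (walk_eigenvalue w))).
rewrite -[LHS]mulmx1 -(proj1 repT) walk_operator_annihilated // => Y _.
by rewrite mem_undup codom_f.
Qed.

(** The weight [u] is the [k]-fold convolution power of [w]. Its partial sums are
multiplicative because a product has support below [X] exactly when both factors
have. *)
Lemma walk_operator_exp n (T : S -> 'M[R]_n) w k : lrb_representation T ->
  exists2 u : S -> R, walk_operator T w ^+ k = walk_operator T u &
    forall X, walk_eigenvalue u X = walk_eigenvalue w X ^+ k.
Proof.
move=> [T1 TM]; elim: k => [|k [u defPk eigu]].
  exists (fun x => (x == 1%g)%:R) => [|X].
    rewrite expr0 /walk_operator (bigD1 1%g) //= eqxx scale1r T1 big1 ?addr0 // => x.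
    by move=> /negbTE->; rewrite scale0r.
  have supp1 : (supp (1%g : S) <= X)%O.
    by rewrite -(supp_reprK S X) -[supp_repr S X]mul1g suppM leUl.
  rewrite expr0 /walk_eigenvalue (bigD1 1%g) //= eqxx big1 ?addr0 // => x.
  by move=> /andP[_ /negbTE->].
exists (fun z => \sum_(p : S * S | (p.2 * p.1)%g == z) u p.1 * w p.2) => [|X].
  rewrite exprSr defPk -[_ * _]/(_ *m _) /walk_operator mulmx_suml.
  under eq_bigr => x _ do rewrite mulmx_sumr.
  rewrite pair_big /= (partition_big (fun p : S * S => (p.2 * p.1)%g) predT) //=.
  apply: eq_bigr => z _; rewrite scaler_suml; apply: eq_bigr => p /eqP <-.
  by rewrite -scalemxAl -scalemxAr scalerA -TM.
rewrite exprSr -eigu /walk_eigenvalue mulr_suml.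
under [RHS]eq_bigr => x _ do rewrite mulr_sumr.
rewrite pair_big /= (exchange_big_dep (fun p : S * S => (supp p.1 <= X)%O && (supp p.2 <= X)%O)) /=.
  apply: eq_bigr => p /andP[p1 p2].
  rewrite (bigD1 (p.2 * p.1)%g) ?suppM ?leUx ?p1 ?p2 ?eqxx //= big1 ?addr0 // => z.
  by move=> /andP[/andP[_ /eqP ->]]; rewrite eqxx.
by move=> z p zX /eqP defz; rewrite andbC -leUx -suppM defz.
Qed.

Section Multiplicities.
Context n (T : S -> 'M[R]_n) (repT : lrb_representation T).
Context (c m : L -> int) (trT : forall x, \tr (T x) = (c (supp x))%:~R).
Context (summ : forall X, \sum_(Y | (X <= Y)%O) m Y = c X).

Lemma trace_walk_operator_exp w k :
  \tr (walk_operator T w ^+ k) = \sum_X (m X)%:~R * walk_eigenvalue w X ^+ k.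
Proof.
have [u -> eigu] := walk_operator_exp w k repT.
rewrite linear_sum /=.
under eq_bigr => x _ do
  rewrite mxtraceZ trT -summ rmorph_sum mulr_sumr.
rewrite (exchange_big_dep predT) //=; apply: eq_bigr => X _.
by rewrite -mulr_suml mulrC -eigu.
Qed.

Lemma eigenvalue_multiplicities w (D : 'rV[R]_n) :
  (forall k, \tr (walk_operator T w ^+ k) = \sum_i D 0 i ^+ k) ->
  forall a, \sum_(X | walk_eigenvalue w X == a) m X = #|[set i | D 0 i == a]|%:Z.
Proof.
move=> trD; apply: weighted_power_sums => k.
by rewrite -trD trace_walk_operator_exp.
Qed.

Lemma multiplicity_ge0 X : 0 <= m X.
Proof.
have diag := walk_operator_diagonalizable repT (separating_weight_ge0 X).
have [D [_ _ trD]] := diagonalizable_spectrum diag.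
have := eigenvalue_multiplicities trD (walk_eigenvalue (separating_weight (S := S) X) X).
rewrite (eq_bigl (pred1 X)) => [|Y]; last by rewrite separating_weightP.
by rewrite big_pred1_eq => ->.
Qed.

End Multiplicities.
End Representation.

(** * The action on chambers *)

Section ChamberRepresentation.
Context {d : Order.disp_t} {L : finTBLatticeType d} (S : lrbType L) (R : realType).
Implicit Types (x y z : S).

Definition chamber_mx x : 'M[R]_#|chambers S| :=
  \matrix_(i, j) (x * enum_val i == enum_val j)%g%:R.

Lemma chamber_mulg_ex x (i : 'I_#|chambers S|) :
  exists j : 'I_#|chambers S|, (x * enum_val i)%g = enum_val j.
Proof.
have xi : (x * enum_val i)%g \in chambers S.
  by have := enum_valP i; rewrite !inE suppM => /eqP->; rewrite joinx1.
by exists (enum_rank_in xi (x * enum_val i)%g); rewrite enum_rankK_in.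
Qed.

Lemma chamber_mx_representation : lrb_representation chamber_mx.
Proof.
split=> [|x y]; apply/matrixP => i j; rewrite !mxE.
  by rewrite mul1g (inj_eq enum_val_inj).
have [k yi] := chamber_mulg_ex y i.
rewrite (bigD1 k) //= !mxE -mulgA yi eqxx mul1r big1 ?addr0 // => l lk.
by rewrite !mxE yi (inj_eq enum_val_inj) eq_sym (negbTE lk) mul0r.
Qed.

(** A chamber [c] contributes to the trace exactly when [x * c = c], that is, when
[c] lies above [x]. *)
Lemma trace_chamber_mx x : \tr (chamber_mx x) = (nchambers S (supp x))%:R.
Proof.
rewrite nchambersE /nchambers_above -sum1dep_card big_mkcondr natr_sum.
rewrite (big_enum_val (fun c => (if lrb_le x c then 1%N else 0%N)%:R)).
by apply: eq_bigr => i _; rewrite mxE /lrb_le; case: eqP.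
Qed.

Lemma walk_matrixE (w : S -> R) : walk_matrix w = walk_operator chamber_mx w.
Proof.
apply/matrixP => i j; rewrite mxE summxE big_mkcond /=.
by apply: eq_bigr => x _; rewrite !mxE mulr_natr mulrb.
Qed.

End ChamberRepresentation.

Theorem theorem1 (R : realType) (d : Order.disp_t) (L : finTBLatticeType d)
    (S : lrbType L) (w : S -> R)
    (w_ge0 : forall x, 0 <= w x) (w_sum1 : \sum_(x : S) w x = 1) :
  diagonalizable (walk_matrix w) /\
  exists m : L -> nat,
    [/\ char_poly (walk_matrix w) =
          \prod_(X : L) ('X - (walk_eigenvalue w X)%:P) ^+ m X,
        forall a : R, \rank (eigenspace (walk_matrix w) a) =
          (\sum_(X : L | walk_eigenvalue w X == a) m X)%N,
        forall X : L, (\sum_(Y : L | (X <= Y)%O) m Y)%N = nchambers S X,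
        forall n : L -> int,
          (forall X, \sum_(Y : L | (X <= Y)%O) n Y = (nchambers S X)%:Z) ->
          forall X, n X = (m X)%:Z &
        forall n : L -> int,
          (forall X, \sum_(Y : L | (X <= Y)%O) n Y = (nchambers S X)%:Z) <->
          (forall X, n X =
             \sum_(Y : L | (X <= Y)%O) moebius X Y * (nchambers S Y)%:Z)].
Proof.
have inversion n := moebius_inversion n (fun Y => (nchambers S Y)%:Z).
pose m X := \sum_(Y : L | (X <= Y)%O) moebius X Y * (nchambers S Y)%:Z.
have summ := proj2 (inversion m) (fun=> erefl).
have repT := chamber_mx_representation S R.
have trT (x : S) : \tr (chamber_mx R x) = (nchambers S (supp x))%:Z%:~R.
  by rewrite trace_chamber_mx pmulrn.
have mE X : m X = `|m X|%N.
  by rewrite gez0_abs // (multiplicity_ge0 repT trT summ).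
have diag : diagonalizable (walk_matrix w).
  by rewrite walk_matrixE; exact: walk_operator_diagonalizable.
split=> //; exists (fun X => `|m X|%N).
have [D [charD rankD trD]] := diagonalizable_spectrum diag.
have mult a : #|[set i | D 0 i == a]| =
    (\sum_(X : L | walk_eigenvalue w X == a) `|m X|)%N.
  rewrite walk_matrixE in trD.
  apply/eqP; rewrite -eqz_nat -(eigenvalue_multiplicities repT trT summ trD).
  by rewrite (big_morph Posz PoszD (erefl 0)); apply/eqP/eq_bigr => X _.
split=> // [|a|X|n sumn X].
- by rewrite charD; exact: (prod_by_multiplicity (fun a => 'X - a%:P) mult).
- by rewrite rankD mult.
- apply/eqP; rewrite -eqz_nat -summ (big_morph Posz PoszD (erefl 0)).
  by apply/eqP/eq_bigr => Y _.
- by rewrite -mE (proj1 (inversion n) sumn).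
Qed.
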